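(* Let $i_1,\dots,i_k$ be distinct positive integers and $p_1,\dots,p_k>0$ with $p_1+\dots+p_k=1$; a ''die'' shows $i_r$ with probability $p_r$. For a positive integer $n$, in the solitaire game one starts with capital $0$ and repeatedly rolls the die, adding the outcome to the capital, until the capital is $\ge n$; let $b_{j,n}$ be the probability that this takes exactly $j$ rolls. In the two-player game the players alternately roll the die, each accumulating their own capital starting from $0$ (rolls independent), and the first to reach capital $\ge n$ wins. Let $f(n)$ be the probability that the player who moves first wins. Then $f(n)=(1+a(n))/2$ with $a(n)=\sum_{j\ge1}b_{j,n}^2$, and the sequence $a(n)$ (hence also $f(n)$) is P-recursive: there exist an integer $L\ge1$ and polynomials $c_0(n),\dots,c_L(n)$, not all zero, such that $\sum_{i=0}^{L}c_i(n)\,a(n-i)=0$ for all $n> L$. *)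

(* Defs.v *)
From HB Require Import structures.
From mathcomp Require Import all_boot all_order all_algebra.
From mathcomp Require Import finmap.
From mathcomp Require Import all_classical all_reals all_analysis.
Set Implicit Arguments.
Unset Strict Implicit.
Unset Printing Implicit Defensive.
Import Order.TTheory GRing.Theory Num.Theory.
Local Open Scope classical_set_scope.
Local Open Scope ring_scope.

Definition mutually_independent (R : realType) (d d' : measure_display)
    (T : measurableType d) (E : measurableType d') (P : probability T R)
    (I : choiceType) (X : I -> {RV P >-> E}) : Prop :=
  forall (J : {fset I}) (A : I -> set E),
    (forall i, measurable (A i)) ->
    P (\bigcap_(i in [set` J]) (X i @^-1` A i)) =
    (\prod_(i <- J) P (X i @^-1` A i))%E.

(* [X t] is the outcome of roll number [t], with rolls numbered from 0. *)
Definition die_rolls (R : realType) (d : measure_display)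
    (T : measurableType d) (P : probability T R) (k : nat)
    (face : 'I_k -> nat) (p : 'I_k -> R) (X : nat -> {RV P >-> nat}) : Prop :=
  mutually_independent X /\
  forall (t : nat) (r : 'I_k), P [set w | X t w = face r] = (p r)%:E.

Section Games.
Variables (R : realType) (d : measure_display) (T : measurableType d).
Variables (P : probability T R) (X : nat -> {RV P >-> nat}).

Definition capital (j : nat) (w : T) : nat := (\sum_(t < j) X t w)%N.

Definition solitaire_takes (n j : nat) : set T :=
  [set w | (n <= capital j w)%N /\
           forall i : nat, (i < j)%N -> (capital i w < n)%N].

Definition solitaire_prob (j n : nat) : R := fine (P (solitaire_takes n j)).

(* In the two-player game the same sequence of rolls is used alternately: the
   first mover ([second = false]) makes the rolls of even number, the other
   player those of odd number. [t] counts the rolls made by both players. *)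
Definition player_capital (second : bool) (t : nat) (w : T) : nat :=
  (\sum_(u < t | odd u == second) X u w)%N.

(* At some moment the first mover has reached [n] while the opponent has not. *)
Definition first_wins (n : nat) : set T :=
  [set w | exists t : nat, (n <= player_capital false t w)%N /\
                           (player_capital true t w < n)%N].

Definition first_win_prob (n : nat) : R := fine (P (first_wins n)).

(* The outcomes being positive, the terms with [j > n] vanish, so that the
   limit of the partial sums exists. *)
Definition sum_sq_prob (n : nat) : R :=
  \big[+%R/0]_(1 <= j <oo) (solitaire_prob j n) ^+ 2.

End Games.

(* Only the values [u m] with [m >= 1] are involved. *)
Definition P_recursive (R : realType) (u : nat -> R) : Prop :=
  exists L : nat, (1 <= L)%N /\
  exists c : 'I_L.+1 -> {poly R},
    (exists i, c i != 0) /\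
    forall n : nat, (L < n)%N ->
      \sum_(i < L.+1) (c i).[n%:R] * u (n - i)%N = 0.

(* Main.v *)
Require Import Defs.
From HB Require Import structures.
From mathcomp Require Import all_boot all_order all_algebra.
From mathcomp Require Import finmap ring zify.
From mathcomp Require Import all_classical all_reals all_analysis.
From mathcomp Require Import measurable_realfun.
Set Implicit Arguments.
Unset Strict Implicit.
Unset Printing Implicit Defensive.
Import Order.TTheory GRing.Theory Num.Theory.
Local Open Scope classical_set_scope.
Local Open Scope ring_scope.

(** Let g(x) be the generating polynomial of the die, so that the capital after
    j rolls has law [x^m] g(x)^j. As 1 - g(x) = (1 - x) T(x) for a polynomial T,
    b_{j+1,n} is the coefficient of x^n in x T(x) g(x)^j, whence a(n) is the
    diagonal coefficient of the rational function
    x T(x) y T(y) / (1 - g(x) g(y)).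

    Diagonals of rational functions are P-recursive, by an argument of Lipshitz.
    To F = P / (1 - h) one applies, in the variables s = x and t = x y, the
    operators t^a (t d/dt)^b (d/ds)^c. Those with a, b, c <= N number about N^3,
    but their values are polynomials of degree O(N) over a fixed power of 1 - h,
    a space of dimension O(N^2). A dependence relation, restricted to the
    diagonal, is the recurrence.

    Writing B_j for the probability that the capital after j rolls is still
    below n, the first player wins with probability
    sum_j (B_j - B_{j+1}) B_j, and 2 (B_j - B_{j+1}) B_j =
    B_j^2 - B_{j+1}^2 + (B_j - B_{j+1})^2 telescopes to 1 + a(n). *)

(** * Diagonals of bivariate rational functions *)

Lemma linear_dependence (K : fieldType) (I J : finType) (w : I -> J -> K) :
  (#|J| < #|I|)%N ->
  exists2 q : I -> K, exists i, q i != 0 & forall j, \sum_i q i * w i j = 0.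
Proof.
move=> ltJI.
pose M : 'M[K]_(#|I|, #|J|) := \matrix_(i, j) w (enum_val i) (enum_val j).
have /rowV0Pn[q /sub_kermxP qM /rV0Pn[i qi]] : kermx M != 0.
  by rewrite kermx_eq0 /row_free neq_ltn (leq_ltn_trans (rank_leq_col M)).
exists (q 0 \o enum_rank) => [|j].
  by exists (enum_val i); rewrite /= enum_valK.
have /matrixP/(_ 0 (enum_rank j)) := qM; rewrite !mxE; apply: etrans.
rewrite [RHS](reindex enum_rank) /=; last exact/onW_bij/enum_rank_bij.
by apply: eq_bigr => x _; rewrite mxE !enum_rankK.
Qed.

Section GeometricExpansion.
Variables (A : comNzRingType) (h : {poly A}).

(* The coefficient of x^m in P / (1 - h)^(a + 1), for [h] without constant
   coefficient. *)
Definition geom_coef (a m : nat) (P : {poly A}) : A :=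
  \sum_(j < m.+1) (P * h ^+ j)`_m *+ 'C(j + a, a).

Lemma geom_coef_is_linear a m : linear_for *%R (geom_coef a m).
Proof.
move=> c P Q; rewrite /geom_coef mulr_sumr -big_split; apply: eq_bigr => j _.
by rewrite mulrDl coefD -scalerAl coefZ mulrnDl mulrnAr.
Qed.

HB.instance Definition _ a m :=
  GRing.isLinear.Build A {poly A} A *%R (geom_coef a m)
    (geom_coef_is_linear a m).

Hypothesis h_coef0 : h`_0 = 0.

Lemma coef_mul_expr_eq0 P j m : (m < j)%N -> (P * h ^+ j)`_m = 0.
Proof.
have /factor_theorem[q ->] : root h 0 by rewrite /root horner_coef0 h_coef0.
by move=> ltmj; rewrite subr0 exprMn mulrA coefMXn ltmj.
Qed.

Lemma geom_coefE B a m P : (m < B)%N ->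
  geom_coef a m P = \sum_(j < B) (P * h ^+ j)`_m *+ 'C(j + a, a).
Proof.
move=> ltmB; rewrite /geom_coef.
rewrite (big_ord_widen B (fun j => (P * h ^+ j)`_m *+ 'C(j + a, a))) //.
rewrite big_mkcond; apply: eq_bigr => j _; case: ltnP => // ltmj.
by rewrite coef_mul_expr_eq0 ?mul0rn.
Qed.

Lemma geom_coefMXn a m i P : geom_coef a m (P * 'X^i) =
  if (i <= m)%N then geom_coef a (m - i) P else 0.
Proof.
rewrite {1}/geom_coef; under eq_bigr do rewrite mulrAC coefMXn ltnNge if_neg.
case: ifP => [leim|_]; last by rewrite big1 // => j _; rewrite mul0rn.
by rewrite (@geom_coefE m.+1) // ltnS leq_subr.
Qed.

Lemma geom_coef_raise a m P : geom_coef a m P = geom_coef a.+1 m (P * (1 - h)).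
Proof.
rewrite [P * _]mulrBr mulr1 raddfB /= !(@geom_coefE m.+2 _ _ P) //.
rewrite /geom_coef !(big_ord_recl m.+1) !binn -addrA -sumrB.
congr (_ + _); apply: eq_bigr => j _; rewrite lift0.
by rewrite -mulrA -exprS !addSn !addnS binS mulrnDr addrAC subrr add0r.
Qed.

Lemma geom_coef_leibniz (D : {poly A} -> {poly A}) a m P :
  (forall Q1 Q2, D (Q1 * Q2) = D Q1 * Q2 + Q1 * D Q2) ->
  \sum_(j < m.+2) (D (P * h ^+ j))`_m *+ 'C(j + a, a) =
  geom_coef a m (D P) + geom_coef a.+1 m (P * D h) *+ a.+1.
Proof.
move=> DM; have D_pow j Q : D (Q * h ^+ j.+1) =
    D Q * h ^+ j.+1 + Q * D h * h ^+ j *+ j.+1.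
  elim: j Q => [|j IH] Q; first by rewrite !expr1 expr0 mulr1 DM.
  by rewrite exprS mulrA IH DM exprS; ring.
rewrite (@geom_coefE m.+2 a) // !(big_ord_recl m.+1) !expr0 !mulr1 -addrA.
congr (_ + _); rewrite -sumrMnl -big_split; apply: eq_bigr => j _.
rewrite lift0 D_pow coefD coefMn mulrnDl -!mulrnA; congr (_ + _ *+ _).
by rewrite [RHS]mulnC mul_bin_left addnS -addSn addnK.
Qed.

End GeometricExpansion.

Section BivariateExpansion.
Variable K : comNzRingType.
Implicit Types P Q : {poly {poly K}}.

(* The operator u x d/dx + v y d/dy. *)
Definition euler (u v : K) P : {poly {poly K}} :=
  u%:P *: ('X * P^`()) + v%:P *: swapXY ('X * (swapXY P)^`()).

Lemma coef_euler u v P m n :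
  (euler u v P)`_m`_n = (u *+ m + v *+ n) * P`_m`_n.
Proof.
have coef_Xderiv (S : comNzRingType) (q : {poly S}) i :
    ('X * q^`())`_i = q`_i *+ i.
  by rewrite coefXM; case: i => [|i]; rewrite ?mulr0n ?coef_deriv.
rewrite coefD !coefZ coefD !coefCM coef_swapXY !coef_Xderiv.
by rewrite !coefMn coef_swapXY mulrDl !mulrnAl !mulrnAr.
Qed.

Lemma eulerM u v P Q :
  euler u v (P * Q) = euler u v P * Q + P * euler u v Q.
Proof.
rewrite /euler (rmorphM _ P) !derivM !mulrDr (rmorphD swapXY) !rmorphM /=.
by rewrite !swapXYK -!mul_polyC; ring.
Qed.

Variable h : {poly {poly K}}.
Hypothesis h_coef0 : h`_0 = 0.

Lemma affine_geom_coef u v t a m n P :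
  (u *+ m + v *+ n + t) * (geom_coef h a m P)`_n =
  (geom_coef h a.+1 m ((euler u v P + t%:P%:P * P) * (1 - h)
                       + (P * euler u v h) *+ a.+1))`_n.
Proof.
rewrite raddfD /= raddfMn /= -(geom_coef_raise h_coef0) raddfD /=.
rewrite mul_polyC linearZ /= (addrAC (geom_coef _ _ _ _)).
rewrite -(geom_coef_leibniz h_coef0 a m P (eulerM u v)).
rewrite coefD coefCM mulrDl; congr (_ + _).
rewrite (@geom_coefE _ _ h_coef0 m.+2) // !coef_sum mulr_sumr.
by apply: eq_bigr => j _; rewrite !coefMn coef_euler mulrnAr.
Qed.

Definition bideg_lt (d : nat) P : Prop :=
  forall i j, (d <= i)%N || (d <= j)%N -> P`_i`_j = 0.

Lemma bideg_ltW d e P : (d <= e)%N -> bideg_lt d P -> bideg_lt e P.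
Proof. by move=> lede dP i j gee; apply: dP; lia. Qed.

Lemma exists_bideg_lt P : exists d, bideg_lt d P.
Proof.
exists (maxn (size P) (sizeY P)) => i j.
rewrite !geq_max => /orP[]/andP[leX leY].
  by rewrite [P`_i]nth_default // coef0.
by rewrite nth_default // (leq_trans (max_size_coefXY _ _)).
Qed.

Lemma bideg_lt1 : bideg_lt 1 1.
Proof.
by move=> [|i] [|j] // _; rewrite coef1 ?coef0 // coef1.
Qed.

Lemma bideg_lt_monomial i j e :
  (i <= e)%N -> (j <= e)%N -> bideg_lt e.+1 ('X^j *: 'X^i).
Proof.
move=> leie leje i' j' ge; rewrite coefZ coefXn mulr_natr coefMn coefXn.
by do 2 case: eqP => //=; lia.
Qed.

Lemma bideg_ltD d P Q : bideg_lt d P -> bideg_lt d Q -> bideg_lt d (P + Q).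
Proof. by move=> dP dQ i j ge; rewrite !coefD dP ?dQ ?addr0. Qed.

Lemma bideg_ltN d P : bideg_lt d P -> bideg_lt d (- P).
Proof. by move=> dP i j ge; rewrite !coefN dP ?oppr0. Qed.

Lemma bideg_ltMn d P k : bideg_lt d P -> bideg_lt d (P *+ k).
Proof. by move=> dP i j ge; rewrite !coefMn dP ?mul0rn. Qed.

Lemma bideg_ltZ d c P : bideg_lt d P -> bideg_lt d (c%:P *: P).
Proof. by move=> dP i j ge; rewrite coefZ coefCM dP ?mulr0. Qed.

Lemma bideg_lt_euler d u v P : bideg_lt d P -> bideg_lt d (euler u v P).
Proof. by move=> dP i j ge; rewrite coef_euler dP ?mulr0. Qed.

Lemma bideg_ltM d e P Q :
  bideg_lt d P -> bideg_lt e.+1 Q -> bideg_lt (d + e) (P * Q).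
Proof.
move=> dP eQ i j ge; rewrite coefM coef_sum big1 // => i1 _.
rewrite coefM big1 // => j1 _; have [lti ltj] := (ltn_ord i1, ltn_ord j1).
have [lt_d|ge_d] := boolP ((i1 < d) && (j1 < d))%N.
  by rewrite eQ ?mulr0 //; lia.
by rewrite dP ?mul0r //; lia.
Qed.

Definition is_expansion (a d : nat) (f : nat -> nat -> K) : Prop :=
  exists2 P, bideg_lt d P & forall m n, f m n = (geom_coef h a m P)`_n.

Definition shift2 (i j : nat) (f : nat -> nat -> K) (m n : nat) : K :=
  if (i <= m)%N && (j <= n)%N then f (m - i)%N (n - j)%N else 0.

Lemma is_expansion_shift2 a d e i j f : (i <= e)%N -> (j <= e)%N ->
  is_expansion a d f -> is_expansion a (d + e) (shift2 i j f).
Proof.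
move=> leie leje [P dP fE]; exists (P * ('X^j *: 'X^i)) => [|m n].
  exact/bideg_ltM/bideg_lt_monomial.
rewrite -scalerAr linearZ /= geom_coefMXn // coefXnM ltnNge if_neg /shift2 fE.
by case: (i <= m)%N; case: (j <= n)%N; rewrite /= ?coef0.
Qed.

Variable C : nat.
Hypothesis h_bideg : bideg_lt C.+1 h.

(* Differentiation raises the order of the pole by one, and the bidegree by that
   of [h]. *)
Lemma is_expansion_affine u v t a d f : is_expansion a d f ->
  is_expansion a.+1 (d + C) (fun m n => (u *+ m + v *+ n + t) * f m n).
Proof.
move=> [P dP fE].
exists ((euler u v P + t%:P *: P) * (1 - h) + (P * euler u v h) *+ a.+1).
  have P_num : bideg_lt d (euler u v P + t%:P *: P).
    by apply: bideg_ltD; [exact: bideg_lt_euler|exact: bideg_ltZ].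
  have h_den : bideg_lt C.+1 (1 - h).
    by apply: bideg_ltD; [exact: bideg_ltW bideg_lt1|exact: bideg_ltN].
  apply: bideg_ltD; first exact: bideg_ltM.
  exact/bideg_ltMn/bideg_ltM/bideg_lt_euler.
by move=> m n; rewrite fE affine_geom_coef mul_polyC.
Qed.

Lemma is_expansion_ext a d f g :
  (forall m n, f m n = g m n) -> is_expansion a d g -> is_expansion a d f.
Proof. by move=> fg [P dP gE]; exists P => // m n; rewrite fg. Qed.

(* In the variables s = x and t = x y, and up to a power of s, the coefficients
   of (t d/dt)^b (d/ds)^c applied to s^-1 f. *)
Definition twist (b c : nat) (f : nat -> nat -> K) (m n : nat) : K :=
  n%:R ^+ b * (\prod_(l < c) (m%:R - n%:R - l.+1%:R)) * f m n.

Lemma is_expansion_twist N b c a d f : (b + c <= N)%N ->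
  is_expansion a d f -> is_expansion (a + N) (d + N * C) (twist b c f).
Proof.
move=> + fP; elim: N b c => [|N IH] b c; last rewrite addnS mulSnr addnA.
  rewrite leqn0 addn_eq0 => /andP[/eqP-> /eqP->]; rewrite !addn0.
  by apply: is_expansion_ext fP => m n; rewrite /twist big_ord0 expr0 !mul1r.
case: b => [|b] lebcN; last first.
  have := is_expansion_affine 0 1 0 (IH b c lebcN).
  apply: is_expansion_ext => m n.
  by rewrite /twist exprS mul0rn add0r addr0; ring.
case: c lebcN => [|c] lecN.
  have := is_expansion_affine 0 0 1 (IH 0 0 isT).
  by apply: is_expansion_ext => m n; rewrite !mul0rn !add0r mul1r.
have := is_expansion_affine 1 (-1) (- c.+1%:R) (IH 0 c lecN).
apply: is_expansion_ext => m n.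
by rewrite /twist big_ord_recr /= mulNrn; ring.
Qed.

End BivariateExpansion.

Section Diagonal.
Variables (K : numFieldType) (h : {poly {poly K}}) (C : nat).
Hypothesis h_coef0 : h`_0 = 0.
Hypothesis h_bideg : bideg_lt C.+1 h.

Lemma is_expansion_dependence (I : finType) a d (f : I -> nat -> nat -> K) :
  (d ^ 2 < #|I|)%N -> (forall i, is_expansion h a d (f i)) ->
  exists2 q : I -> K, exists i, q i != 0 &
    forall m n, \sum_i q i * f i m n = 0.
Proof.
move=> ltdI /fin_all_exists2[P dP fE].
have [|q qN0 qP] :=
    @linear_dependence _ I ('I_d * 'I_d)%type (fun i x => (P i)`_x.1`_x.2).
  by rewrite card_prod card_ord mulnn.
exists q => // m n.
have P0 : \sum_i (q i)%:P *: P i = 0.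
  apply/polyP => i; apply/polyP => j; rewrite !coef_sum !coef0.
  under eq_bigr do rewrite coefZ coefCM.
  have [/andP[lti ltj]|] := boolP ((i < d) && (j < d))%N.
    exact: qP (Ordinal lti, Ordinal ltj).
  by move=> ge; rewrite big1 // => x _; rewrite dP ?mulr0 //; lia.
transitivity (geom_coef h a m (\sum_i (q i)%:P *: P i))`_n.
  rewrite raddf_sum coef_sum; apply: eq_bigr => i _.
  by rewrite /= linearZ /= coefCM fE.
by rewrite P0 raddf0 coef0.
Qed.

(* There are of the order of N^3 functions, in a space of dimension of the
   order of N^2. *)
Lemma twist_dependence f : is_expansion h 0 C.+1 f ->
  exists2 N, (0 < N)%N & exists2 q : 'I_N.+1 -> 'I_N.+1 -> 'I_N.+1 -> K,
    exists a b c, q a b c != 0 &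
    forall m n,
      \sum_a \sum_b \sum_c q a b c * shift2 (N - c + a) a (twist b c f) m n = 0.
Proof.
move=> fP; exists (4 * C.+1 ^ 2)%N; first by lia.
set N := (4 * C.+1 ^ 2)%N.
pose F (x : 'I_N.+1 * 'I_N.+1 * 'I_N.+1) :=
  shift2 (N - x.2 + x.1.1) x.1.1 (twist x.1.2 x.2 f).
have FP x : is_expansion h (0 + (N + N)) (C.+1 + (N + N) * C + (N + N)) (F x).
  have [ltb ltc] := (ltn_ord x.1.2, ltn_ord x.2); have lta := ltn_ord x.1.1.
  apply: is_expansion_shift2; rewrite ?leq_add //; try lia.
  by apply: is_expansion_twist => //; lia.
have [|q [[[a b] c] qN0] q0] := is_expansion_dependence _ FP.
  rewrite !card_prod !card_ord.
  have -> : (C.+1 + (N + N) * C + (N + N) = C.+1 * (N + N).+1)%N by lia.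
  have : (C.+1 ^ 2 * 4 < N.+1)%N by rewrite /N; lia.
  have : ((N + N).+1 ^ 2 <= 4 * N.+1 ^ 2)%N by rewrite -!mulnn; lia.
  by rewrite expnMn -!mulnn; nia.
exists (fun a b c => q (a, b, c)); first by exists a, b, c.
move=> m n; rewrite pair_bigA pair_bigA -[RHS](q0 m n).
by apply: eq_bigr => -[[]].
Qed.

Lemma twist_diagonal f b c c0 n : (c0 <= c)%N ->
  twist b c f (n + (c - c0)) n =
  if c == c0 then (\prod_(l < c0) - l.+1%:R : K) * (n%:R ^+ b * f n n) else 0.
Proof.
rewrite leq_eqVlt => /predU1P[<-|lt_c]; rewrite /twist.
  rewrite eqxx subnn addn0 mulrAC [RHS]mulrC; congr (_ * _).
  by apply: eq_bigr => l _; rewrite subrr sub0r.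
have ltl : (c - c0.+1 < c)%N by lia.
rewrite gtn_eqF // (bigD1 (Ordinal ltl)) //= -addrA -opprD -natrD.
have -> : (n + (c - c0.+1).+1 = n + (c - c0))%N by lia.
by rewrite subrr !(mul0r, mulr0).
Qed.

Lemma shift2_twist_diagonal f N a b c c0 n :
  (c0 <= c <= N)%N -> (a <= N < n)%N ->
  shift2 (N - c + a) a (twist b c f) (n + N - c0) n =
  if c == c0
  then (\prod_(l < c0) - l.+1%:R : K) *
       ((n - a)%:R ^+ b * f (n - a)%N (n - a)%N) else 0.
Proof.
move=> /andP[lec0c lecN] /andP[leaN ltNn]; rewrite -twist_diagonal // /shift2.
rewrite ifT; last by apply/andP; split; lia.
by congr (twist _ _ _ _ _); lia.
Qed.

(* Let c1 be the least order in d/ds of a dependence relation. The coefficient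
   of s^(-1-c1) then involves only the terms with c = c1; the powers of x in
   [twist_dependence] place it at m = n + N - c1 in every term. *)
Lemma diagonal_recurrence f : is_expansion h 0 C.+1 f ->
  exists2 L : nat, (0 < L)%N &
  exists2 r : 'I_L.+1 -> {poly K}, exists i, r i != 0 &
    forall n, (L < n)%N ->
      \sum_(i < L.+1) (r i).[n%:R] * f (n - i)%N (n - i)%N = 0.
Proof.
move=> /twist_dependence[N N_gt0 [q [a0 [b0 [c0 qN0]]] q_rel]].
have c0_occurs : [exists a, exists b, q a b c0 != 0].
  by apply/existsP; exists a0; apply/existsP; exists b0.
have [c1 /existsP[a1 /existsP[b1 q1]] c1_min] :=
  @arg_minnP _ c0 (fun c => [exists a, exists b, q a b c != 0]) val c0_occurs.
exists N => //.
exists (fun a : 'I_N.+1 =>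
  (\poly_(b < N.+1) q a (inord b) c1) \Po ('X - a%:R%:P)).
  exists a1; rewrite comp_poly2_eq0 ?size_XsubC //.
  apply: contraNneq q1 => /polyP/(_ b1).
  by rewrite coef_poly ltn_ord inord_val coef0 => ->.
move=> n ltNn.
have signN0 : \prod_(l < c1) - l.+1%:R != 0 :> K.
  by apply/prodf_neq0 => l _; rewrite oppr_eq0 pnatr_eq0.
apply: (mulfI signN0); rewrite mulr0 -[RHS](q_rel (n + N - c1)%N n) mulr_sumr.
apply: eq_bigr => a _.
rewrite horner_comp hornerXsubC horner_poly mulr_suml mulr_sumr.
apply: eq_bigr => b _; rewrite inord_val -natrB; last by have := ltn_ord a; lia.
rewrite [RHS](bigD1 c1) //= [X in _ = _ + X]big1 => [|c cN1]; last first.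
  have [lt_c|ge_c] := ltnP c c1.
    rewrite [q a b c](_ : _ = 0) ?mul0r //; apply: contraTeq lt_c => qabc.
    rewrite -leqNgt; apply: c1_min.
    by apply/existsP; exists a; apply/existsP; exists b.
  rewrite shift2_twist_diagonal ?ltNn ?ge_c -1?ltnS ?ltn_ord //.
  by rewrite val_eqE (negPf cN1) mulr0.
rewrite addr0 shift2_twist_diagonal ?leqnn ?ltNn -1?ltnS ?ltn_ord // eqxx.
by rewrite -mulrA mulrCA.
Qed.

End Diagonal.

Lemma coef_geom_separated (K : comNzRingType) (p q u v : {poly K}) m n :
  (geom_coef (p^:P * q%:P) 0 m (u^:P * v%:P))`_n =
  \sum_(j < m.+1) (u * p ^+ j)`_m * (v * q ^+ j)`_n.
Proof.
rewrite /geom_coef coef_sum; apply: eq_bigr => j _.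
rewrite addn0 bin0 mulr1n exprMn mulrACA -!rmorphXn -!rmorphM /=.
by rewrite coefMC coef_map coefCM.
Qed.

Theorem P_recursive_diagonal (R : realType) (h P : {poly {poly R}}) :
  h`_0 = 0 -> P_recursive (fun n => (geom_coef h 0 n P)`_n).
Proof.
move=> h_coef0.
have [[d1 h_lt] [d2 P_lt]] := (exists_bideg_lt h, exists_bideg_lt P).
have h_bideg : bideg_lt (maxn d1 d2).+1 h by apply: bideg_ltW h_lt; lia.
have P_exp : is_expansion h 0 (maxn d1 d2).+1
    (fun m n => (geom_coef h 0 m P)`_n).
  by exists P => //; apply: bideg_ltW P_lt; lia.
have [L L_gt0 [r rN0 r_rec]] := diagonal_recurrence h_coef0 h_bideg P_exp.
by exists L; split=> //; exists r.
Qed.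

(** * Inhomogeneous recurrences *)

(* Taking the recurrence at n and at n - 1, with factors q(n - 1) and q(n),
   eliminates the right-hand side [q] and keeps a nonzero last coefficient. *)
Lemma P_recursive_inhomogeneous (R : realType) (u : nat -> R) (q : {poly R}) L
    (c : 'I_L.+1 -> {poly R}) :
  (0 < L)%N -> (exists i, c i != 0) ->
  (forall n, (L < n)%N ->
    \sum_(i < L.+1) (c i).[n%:R] * u (n - i)%N = q.[n%:R]) ->
  P_recursive u.
Proof.
move=> L_gt0 [i0 ci0] u_rec; have [q0|qN0] := eqVneq q 0.
  exists L; split=> //; exists c; split=> [|n ltLn]; first by exists i0.
  by rewrite u_rec // q0 horner0.
pose shift : {poly R} := 'X - 1%:P.
pose Q : {poly {poly R}} := \poly_(i < L.+1) c (inord i).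
have QE (i : 'I_L.+1) : Q`_i = c i by rewrite coef_poly ltn_ord inord_val.
have Q_L1 : Q`_L.+1 = 0 by rewrite coef_poly ltnn.
have QN0 : Q != 0 by apply: contraNneq ci0 => Q0; rewrite -QE Q0 coef0.
have size_Q : (size Q <= L.+1)%N by exact: size_poly.
pose elim_coef i := (q \Po shift) * Q`_i - q * (('X * Q)`_i \Po shift).
exists L.+1; split=> //; exists (fun i => elim_coef i); split=> [|n ltLn].
  exists (Ordinal (size_Q : (size Q < L.+2)%N)).
  rewrite /elim_coef /= nth_default // mulr0 sub0r oppr_eq0 mulf_neq0 //.
  rewrite comp_poly2_eq0 ?size_XsubC // coefXM size_poly_eq0 (negPf QN0).
  by rewrite -[_.-1]/(size Q).-1 -lead_coefE lead_coef_eq0.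
have predE : n%:R - 1 = n.-1%:R :> R by rewrite -subn1 natrB //; lia.
under eq_bigr do
  rewrite hornerD hornerN !hornerM !horner_comp hornerXsubC predE.
under eq_bigr do rewrite mulrBl -!mulrA.
rewrite sumrB -!mulr_sumr big_ord_recr [X in _ - _ * X]big_ord_recl /=.
rewrite Q_L1 coefXM !horner0 !mul0r addr0 add0r.
under [X in _ * X - _]eq_bigr do rewrite QE.
under [X in _ - _ * X]eq_bigr do
  rewrite coefXM /bump /= add1n /= QE subnS predn_sub.
by rewrite !u_rec 1?mulrC ?subrr //; lia.
Qed.

Lemma P_recursive_affine (R : realType) (u v : nat -> R) (a b : R) :
  (forall n, (0 < n)%N -> v n = a * u n + b) -> P_recursive u -> P_recursive v.
Proof.
move=> vE [L [L_gt0 [c [cN0 u_rec]]]].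
apply: (P_recursive_inhomogeneous (q := b *: \sum_i c i) L_gt0 cN0) => n ltLn.
transitivity (\sum_(i < L.+1)
    (a * ((c i).[n%:R] * u (n - i)%N) + b * (c i).[n%:R])).
  by apply: eq_bigr => i _; rewrite vE; [ring|have := ltn_ord i; lia].
by rewrite big_split /= -!mulr_sumr u_rec // mulr0 add0r hornerZ horner_sum.
Qed.

(** * Generating functions of the solitaire game *)

Section DiePolynomial.
Variables (K : comNzRingType) (k : nat) (face : 'I_k -> nat) (p : 'I_k -> K).

Definition die_poly : {poly K} := \sum_(r < k) p r *: 'X^(face r).

(* The coefficient of x^u is the probability that one roll exceeds u. *)
Definition tail_poly : {poly K} :=
  \sum_(r < k) p r *: \sum_(u < face r) 'X^u.

(* The probability that the capital after [j] rolls is less than [n]. *)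
Definition capital_cdf (j n : nat) : K := \sum_(m < n) (die_poly ^+ j)`_m.

(* The probability that the capital reaches [n] at roll number [j], counted from
   0: this is b_{j+1,n}. *)
Definition exit_prob (j n : nat) : K := capital_cdf j n - capital_cdf j.+1 n.

Lemma sum_prod_ffun (I : finType) : \sum_r p r = 1 ->
  \sum_(e : {ffun I -> 'I_k}) \prod_i p (e i) = 1.
Proof. by move=> p1; rewrite -(bigA_distr_bigA (fun _ r => p r)) big1. Qed.

Lemma sum_coef_mul1X (q : {poly K}) n :
  \sum_(m < n) ((1 - 'X) * q)`_m = ('X * q)`_n.
Proof.
elim: n => [|n IH]; first by rewrite big_ord0 coefXM.
by rewrite big_ord_recr /= IH mulrBl mul1r coefB [_`_n.+1]coefXM /= addrC subrK.
Qed.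

Lemma mul1X_tail_poly : \sum_r p r = 1 -> (1 - 'X) * tail_poly = 1 - die_poly.
Proof.
move=> p1; rewrite -[in RHS](scale1r 1) -p1 scaler_suml -sumrB mulr_sumr.
apply: eq_bigr => r _; rewrite -scalerAr -scalerBr; congr (_ *: _).
by rewrite -opprB mulNr -subrX1 opprB.
Qed.

Lemma exit_probE j n : \sum_r p r = 1 ->
  exit_prob j n = ('X * tail_poly * die_poly ^+ j)`_n.
Proof.
move=> p1; rewrite -mulrA -sum_coef_mul1X mulrA mul1X_tail_poly //.
rewrite /exit_prob -sumrB.
by apply: eq_bigr => m _; rewrite -coefB mulrBl mul1r -exprS.
Qed.

Hypothesis face_gt0 : forall r, (0 < face r)%N.

Lemma coef0_die_poly : die_poly`_0 = 0.
Proof.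
rewrite coef_sum big1 // => r _.
by rewrite coefZ coefXn eq_sym gtn_eqF ?mulr0.
Qed.

Lemma capital_cdf_eq0 j n : (n <= j)%N -> capital_cdf j n = 0.
Proof.
move=> lenj; apply: big1 => m _; rewrite -[_ ^+ j]mul1r.
exact/(coef_mul_expr_eq0 coef0_die_poly)/(leq_trans (ltn_ord m)).
Qed.

Lemma exit_prob_eq0 j n : (n <= j)%N -> exit_prob j n = 0.
Proof.
by move=> lenj; rewrite /exit_prob !capital_cdf_eq0 ?subrr // ltnW.
Qed.

Lemma capital_cdf0 n : (0 < n)%N -> capital_cdf 0 n = 1.
Proof.
case: n => // n _; rewrite /capital_cdf big_ord_recl big1 ?coef1 ?addr0 //.
by move=> m _; rewrite coef1.
Qed.

Lemma capital_cdfE (I : finType) n : capital_cdf #|I| n =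
  \sum_(e : {ffun I -> 'I_k} | (\sum_i face (e i) < n)%N) \prod_i p (e i).
Proof.
have polyE : die_poly ^+ #|I| = \sum_(e : {ffun I -> 'I_k})
    (\prod_i p (e i)) *: 'X^(\sum_i face (e i)).
  rewrite -prodr_const /die_poly.
  rewrite (bigA_distr_bigA (fun _ r => p r *: 'X^(face r))).
  apply: eq_bigr => e _; rewrite -[RHS]mul_polyC rmorph_prod expr_sum.
  by rewrite -big_split; apply: eq_bigr => i _; rewrite /= mul_polyC.
rewrite /capital_cdf polyE [RHS]big_mkcond /=.
under eq_bigr do rewrite coef_sum.
rewrite exchange_big; apply: eq_bigr => e _.
under eq_bigr do rewrite coefZ coefXn mulr_natr mulrb eq_sym.
rewrite -big_mkcond /=; case: ltnP => [lt_n|ge_n].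
  by rewrite (big_pred1 (Ordinal lt_n)) // => m; rewrite -val_eqE.
by rewrite big1 // => m /eqP; have := ltn_ord m; lia.
Qed.

End DiePolynomial.

(** * Law of the rolls *)

Lemma big_ffun_sum (K : comNzRingType) (I1 I2 J : finType)
    (Q1 : pred {ffun I1 -> J}) (Q2 : pred {ffun I2 -> J}) (F : J -> K) :
  \sum_(e : {ffun I1 + I2 -> J} |
      Q1 [ffun i => e (inl i)] && Q2 [ffun i => e (inr i)]) \prod_x F (e x) =
  (\sum_(e | Q1 e) \prod_i F (e i)) * \sum_(e | Q2 e) \prod_i F (e i).
Proof.
pose glue (e : {ffun I1 -> J} * {ffun I2 -> J}) : {ffun I1 + I2 -> J} :=
  [ffun x => match x with inl i => e.1 i | inr i => e.2 i end].
pose split (e : {ffun I1 + I2 -> J}) : {ffun I1 -> J} * {ffun I2 -> J} :=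
  ([ffun i => e (inl i)], [ffun i => e (inr i)]).
have glueK : cancel glue split.
  by case=> e1 e2; congr (_, _); apply/ffunP => i; rewrite !ffunE.
have splitK : cancel split glue.
  by move=> e; apply/ffunP => -[] i; rewrite !ffunE.
rewrite (reindex glue); last by apply: onW_bij; exists split.
rewrite big_distrlr pair_big /=; apply: eq_big => -[e1 e2].
  by have [-> ->] := glueK (e1, e2).
move=> _; rewrite big_sumType.
by congr (_ * _); apply: eq_bigr => i _; rewrite ffunE.
Qed.

Lemma measurable_fun_sumn d (T : measurableType d) (D : set T) (I : Type)
    (s : seq I) (Q : pred I) (f : I -> T -> nat) :
  (forall i, measurable_fun D (f i)) ->
  measurable_fun D (fun w => \sum_(i <- s | Q i) f i w)%N.
Proof.
move=> mf; elim: s => [|i s IH].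
  by under eq_fun do rewrite big_nil; exact: measurable_cst.
under eq_fun do rewrite big_cons.
by case: (Q i) => //; exact: measurable_fun_addn.
Qed.

Section FiniteOutcomes.
Variables (R : realType) (d : measure_display) (T : measurableType d).
Variable P : probability T R.

Lemma probability_setD (A B : set T) : measurable A -> measurable B ->
  B `<=` A -> P (A `\` B) = (P A - P B)%E.
Proof.
move=> mA mB /setIidPr BA; rewrite measureD ?BA //.
by rewrite -ge0_fin_numE ?fin_num_measure.
Qed.

Lemma measure_bigcup_finType (mu : {measure set T -> \bar R}) (I : finType)
    (Q : pred I) (A : I -> set T) :
  (forall i, measurable (A i)) -> trivIset setT A ->
  mu (\bigcup_(i in [set` Q]) A i) = (\sum_(i | Q i) mu (A i))%E.
Proof.
move=> mA tA; rewrite measure_fin_bigcup //; last exact: sub_trivIset tA.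
apply/esym/bigfs; first exact: index_enum_uniq.
by move=> i _; rewrite mem_index_enum.
Qed.

Lemma probability_finite_partition (I : finType) (A : I -> set T) (E : set T)
    (Q : pred I) :
  (forall i, measurable (A i)) -> trivIset setT A -> (\sum_i P (A i) = 1)%E ->
  measurable E -> (forall i w, A i w -> (E w <-> Q i)) ->
  P E = (\sum_(i | Q i) P (A i))%E.
Proof.
move=> mA tA PA1 mE EQ; pose U := \bigcup_(i in [set` xpredT]) A i.
have mU : measurable U by exact: fin_bigcup_measurable.
have PU : P U = 1%E by rewrite measure_bigcup_finType.
have PUc : P (~` U) = 0%E by rewrite probability_setC // PU subee.
have PEU : P (E `\` U) = 0%E.
  apply: subset_measure0 PUc => [||w []] //; first exact: measurableD.
  exact: measurableC.
have -> : P E = (P (E `\` U) + P (E `&` U))%E by exact: measureDI.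
rewrite PEU add0e -measure_bigcup_finType //.
congr (P _); apply/seteqP; split=> w.
  by move=> [Ew [i _ Aiw]]; exists i => //; apply/(EQ i w).
by move=> [i Qi Aiw]; split; [apply/(EQ i w)|exists i].
Qed.

Lemma mutually_independent_injective (d' : measure_display)
    (E : measurableType d') (J : choiceType) (X : J -> {RV P >-> E})
    (I : finType) (t : I -> J) (A : I -> set E) :
  mutually_independent X -> injective t -> (forall i, measurable (A i)) ->
  P (\bigcap_(i in setT) (X (t i) @^-1` A i)) =
  (\prod_i P (X (t i) @^-1` A i))%E.
Proof.
move=> indepX t_inj mA.
pose B j := if [pick i | t i == j] is Some i then A i else setT.
have BE i : B (t i) = A i.
  rewrite /B; case: pickP => [i' /eqP/t_inj -> //|/(_ i)].
  by rewrite eqxx.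
have mB j : measurable (B j) by rewrite /B; case: pickP.
have := indepX (seq_fset tt (map t (enum I))) B mB.
have /(perm_big _) -> : perm_eq (seq_fset tt (map t (enum I))) (map t (enum I)).
  rewrite -[X in perm_eq _ X]undup_id ?seq_fset_perm //.
  by rewrite map_inj_uniq ?enum_uniq.
rewrite big_map big_enum; under eq_bigr do rewrite BE.
move=> <-; congr (P _); apply/seteqP; split=> w Aw.
  move=> j jt; have /mapP[i _ ->] : j \in map t (enum I).
    by rewrite -(seq_fsetE tt).
  by rewrite BE; exact: Aw.
move=> i _; rewrite -BE; apply: Aw; apply/idP.
by rewrite seq_fsetE map_f ?mem_enum.
Qed.

End FiniteOutcomes.

Lemma sum_subr_mul_telescope (K : comNzRingType) (F : nat -> K) n :
  (\sum_(j < n) (F j - F j.+1) * F j) *+ 2 =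
  F 0%N ^+ 2 - F n ^+ 2 + \sum_(j < n) (F j - F j.+1) ^+ 2.
Proof.
elim: n => [|n IH]; first by rewrite !big_ord0 mul0rn subrr addr0.
by rewrite !big_ord_recr /= mulrnDl IH; ring.
Qed.

Lemma leq_sum_ord (F : nat -> nat) i j :
  (i <= j)%N -> (\sum_(l < i) F l <= \sum_(l < j) F l)%N.
Proof.
move=> leij; rewrite (big_ord_widen j F) // big_mkcond /=.
by apply: leq_sum => l _; case: ifP.
Qed.

Section Rolls.
Variables (R : realType) (d : measure_display) (T : measurableType d).
Variables (P : probability T R) (X : nat -> {RV P >-> nat}).

Lemma measurable_sum_rolls_lt (I : finType) (t : I -> nat) n :
  measurable [set w | (\sum_i X (t i) w < n)%N].
Proof.
have msum : measurable_fun setT (fun w => \sum_i X (t i) w)%N.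
  exact: measurable_fun_sumn.
rewrite -[X in measurable X]setTI.
exact: (msum measurableT [set m | (m < n)%N]).
Qed.

(* The capital of a player after [j] rolls of their own. *)
Definition turn_capital (second : bool) (j : nat) (w : T) : nat :=
  (\sum_(i < j) X (i.*2 + second) w)%N.

Lemma leq_turn_capital b i j w :
  (i <= j)%N -> (turn_capital b i w <= turn_capital b j w)%N.
Proof. exact: (leq_sum_ord (fun l => X (l.*2 + b) w)). Qed.

Lemma player_capitalE b t w :
  player_capital X b t w = turn_capital b (t + ~~ b)./2 w.
Proof.
elim: t => [|t IH].
  by case: b; rewrite /player_capital /turn_capital !big_ord0.
have -> : player_capital X b t.+1 w =
    (player_capital X b t w + if odd t == b then X t w else 0)%N.
  by rewrite /player_capital big_mkcond big_ord_recr -big_mkcond.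
rewrite IH; have [odd_t|odd_t] := eqVneq (odd t) b.
  have -> : ((t.+1 + ~~ b)./2 = (t + ~~ b)./2.+1)%N by lia.
  by rewrite [RHS]big_ord_recr /=; congr (_ + X _ w)%N; lia.
by rewrite addn0; congr turn_capital; lia.
Qed.

Definition both_below (i j n : nat) : set T :=
  [set w | (turn_capital false i w < n)%N /\ (turn_capital true j w < n)%N].

Lemma measurable_both_below i j n : measurable (both_below i j n).
Proof. by apply: measurableI; exact: measurable_sum_rolls_lt. Qed.

Lemma both_belowS i j n : both_below i.+1 j n `<=` both_below i j n.
Proof.
move=> w [lt1 lt2]; split=> //.
exact: leq_ltn_trans (leq_turn_capital false w (leqnSn i)) lt1.
Qed.

(* The first mover reaches [n] at their roll number [j], counted from 0, while
   the opponent, after [j] rolls, has not. *)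
Definition wins_at (n j : nat) : set T :=
  both_below j j n `\` both_below j.+1 j n.

Lemma wins_atP n j w : wins_at n j w <->
  (turn_capital false j w < n <= turn_capital false j.+1 w)%N /\
  (turn_capital true j w < n)%N.
Proof.
split=> [[[lt1 lt2] nlt]|[/andP[lt1 le1] lt2]].
  by split=> //; rewrite lt1 leqNgt; apply/negP => lt1S; apply: nlt.
by split=> // -[]; rewrite ltnNge le1.
Qed.

Lemma trivIset_wins_at n : trivIset setT (wins_at n).
Proof.
apply: ltn_trivIset => j i ltij; apply/seteqP; split=> // w [].
move=> /wins_atP[/andP[_ lei] _] /wins_atP[/andP[ltj _] _].
by have := leq_turn_capital false w ltij; lia.
Qed.

Lemma first_wins_bigcup n : (0 < n)%N -> first_wins X n = \bigcup_j wins_at n j.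
Proof.
move=> n_gt0; apply/seteqP; split=> w.
  move=> [t]; rewrite !player_capitalE /= addn1 addn0 => -[le1 lt2].
  have reached : exists j, (n <= turn_capital false j w)%N by exists t.+1./2.
  case: (ex_minnP reached) => -[|j] lej jmin.
    by move: lej; rewrite /turn_capital big_ord0; lia.
  exists j => //; apply/wins_atP; rewrite lej andbT; split.
    by rewrite ltnNge; apply/negP => /jmin; rewrite ltnn.
  apply: leq_ltn_trans lt2; apply: leq_turn_capital.
  by have := jmin _ le1; lia.
move=> [j _ /wins_atP[/andP[_ le1] lt2]]; exists j.*2.+1.
rewrite !player_capitalE addn1 -doubleS doubleK addn0; split=> //.
by rewrite -[_.*2.+1]add1n (half_bit_double j true).
Qed.

Lemma solitaire_takesS n j : solitaire_takes X n j.+1 =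
  [set w | (capital X j w < n)%N] `\` [set w | (capital X j.+1 w < n)%N].
Proof.
apply/seteqP; split=> w /=.
  by move=> [leq_n lt_n]; split; [exact: lt_n|apply/negP; rewrite -leqNgt].
move=> [lt_n /negP]; rewrite -leqNgt => le_n; split=> // i.
rewrite ltnS => leij.
exact: leq_ltn_trans (leq_sum_ord (fun t => X t w) leij) lt_n.
Qed.

Variables (k : nat) (face : 'I_k -> nat) (p : 'I_k -> R).
Hypothesis face_inj : injective face.
Hypothesis face_gt0 : forall r : 'I_k, (0 < face r)%N.
Hypothesis p_sum1 : \sum_(r < k) p r = 1.
Hypothesis X_rolls : die_rolls face p X.

Lemma prob_rolls (I : finType) (t : I -> nat) (E : set T)
    (Q : pred {ffun I -> 'I_k}) :
  injective t -> measurable E ->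
  (forall (e : {ffun I -> 'I_k}) w,
    (forall i, X (t i) w = face (e i)) -> (E w <-> Q e)) ->
  P E = (\sum_(e | Q e) \prod_i p (e i))%:E.
Proof.
move=> t_inj mE EQ.
pose A (e : {ffun I -> 'I_k}) :=
  \bigcap_(i in setT) (X (t i) @^-1` [set face (e i)]).
have PA e : P (A e) = (\prod_i p (e i))%:E.
  rewrite mutually_independent_injective //; last exact: X_rolls.1.
  by rewrite -prodEFin; apply: eq_bigr => i _; exact: X_rolls.2.
rewrite (@probability_finite_partition _ _ _ _ _ A _ Q) //.
- by under eq_bigr do rewrite PA; rewrite sumEFin.
- by move=> e; apply: fin_bigcap_measurable => // i _; exact: measurable_funPTI.
- move=> e e' _ _ [w [we we']]; apply/ffunP => i; apply: face_inj.
  by rewrite -(we i) // -(we' i).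
- by under eq_bigr do rewrite PA; rewrite sumEFin sum_prod_ffun.
- by move=> e w we; apply: EQ => i; exact: we.
Qed.

Lemma prob_sum_rolls_lt (I : finType) (t : I -> nat) n : injective t ->
  P [set w | (\sum_i X (t i) w < n)%N] = (capital_cdf face p #|I| n)%:E.
Proof.
move=> t_inj; rewrite capital_cdfE.
apply: (prob_rolls t_inj) => [|e w we]; first exact: measurable_sum_rolls_lt.
by rewrite /= (eq_bigr _ (fun i _ => we i)).
Qed.

Lemma prob_capital_lt j n :
  P [set w | (capital X j w < n)%N] = (capital_cdf face p j n)%:E.
Proof. by rewrite (prob_sum_rolls_lt n (@ord_inj j)) card_ord. Qed.

Lemma prob_both_below i j n :
  P (both_below i j n) = (capital_cdf face p i n * capital_cdf face p j n)%:E.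
Proof.
pose t (x : 'I_i + 'I_j) :=
  match x with inl l => l.*2 + false | inr l => l.*2 + true end%N.
have t_inj : injective t.
  move=> [l|l] [l'|l'] /= tE; try by exfalso; lia.
    by congr inl; apply: ord_inj; lia.
  by congr inr; apply: ord_inj; lia.
pose Q (I : finType) (e : {ffun I -> 'I_k}) := (\sum_l face (e l) < n)%N.
rewrite -[in RHS](card_ord i) -[in RHS](card_ord j) !capital_cdfE.
rewrite -(big_ffun_sum (@Q 'I_i) (@Q 'I_j)).
apply: (prob_rolls t_inj) => [|e w we]; first exact: measurable_both_below.
have firstE :
    turn_capital false i w = (\sum_l face ([ffun l => e (inl l)] l))%N.
  by apply: eq_bigr => l _; rewrite ffunE -we.
have secondE :
    turn_capital true j w = (\sum_l face ([ffun l => e (inr l)] l))%N.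
  by apply: eq_bigr => l _; rewrite ffunE -we.
by rewrite /both_below /= firstE secondE; split=> /andP.
Qed.

Lemma prob_wins_at n j :
  P (wins_at n j) = (exit_prob face p j n * capital_cdf face p j n)%:E.
Proof.
rewrite /exit_prob probability_setD ?prob_both_below -?EFinB ?mulrBl //.
- exact: measurable_both_below.
- exact: measurable_both_below.
- exact: both_belowS.
Qed.

Lemma first_win_probE n : (0 < n)%N ->
  first_win_prob X n =
  \sum_(j < n) exit_prob face p j n * capital_cdf face p j n.
Proof.
move=> n_gt0; rewrite /first_win_prob first_wins_bigcup //.
have mwins j : measurable (wins_at n j).
  by apply: measurableD; exact: measurable_both_below.
have -> : P (\bigcup_j wins_at n j) = (\sum_(0 <= j <oo) P (wins_at n j))%E.
  apply: measure_semi_bigcup => //; first exact: trivIset_wins_at.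
  exact: bigcupT_measurable.
rewrite (nneseries_split _ n) // add0n big_mkord [X in (_ + X)%E]eseries0.
  by rewrite adde0; under eq_bigr do rewrite prob_wins_at; rewrite sumEFin.
move=> j lenj _.
by rewrite prob_wins_at (capital_cdf_eq0 _ face_gt0 lenj) mulr0.
Qed.

Lemma solitaire_probS j n :
  solitaire_prob X j.+1 n = exit_prob face p j n.
Proof.
rewrite /solitaire_prob solitaire_takesS probability_setD ?prob_capital_lt //.
- exact: measurable_sum_rolls_lt.
- exact: measurable_sum_rolls_lt.
- move=> w; apply: leq_ltn_trans.
  by rewrite /capital big_ord_recr leq_addr.
Qed.

Lemma sum_sq_probE B n : (n <= B)%N ->
  sum_sq_prob X n = \sum_(j < B) exit_prob face p j n ^+ 2.
Proof.
move=> lenB.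
apply: (@lim_near_cst R^o (@norm_hausdorff _ R^o)).
exists B.+1 => // M /= ltBM; rewrite big_add1 big_mkord.
rewrite [RHS](big_ord_widen M.-1 (fun j => exit_prob face p j n ^+ 2));
  last by lia.
rewrite [RHS]big_mkcond; apply: eq_bigr => j _; rewrite solitaire_probS.
case: ltnP => // leBj.
by rewrite exit_prob_eq0 ?expr0n // (leq_trans lenB).
Qed.

Lemma first_win_prob_sum_sq n : (0 < n)%N ->
  first_win_prob X n = (1 + sum_sq_prob X n) / 2.
Proof.
move=> n_gt0; rewrite -[LHS](mulfK (_ : 2 != 0 :> R)) // mulr_natr.
rewrite first_win_probE // (sum_sq_probE (leqnn n)).
rewrite (sum_subr_mul_telescope (fun j => capital_cdf face p j n)).
by rewrite capital_cdf0 // (capital_cdf_eq0 _ face_gt0) // expr1n expr0n subr0.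
Qed.

Lemma P_recursive_sum_sq_prob : P_recursive (sum_sq_prob X).
Proof.
pose Q := 'X * tail_poly face p; pose g := die_poly face p.
have -> : sum_sq_prob X =
    fun n => (geom_coef (g^:P * g%:P) 0 n (Q^:P * Q%:P))`_n.
  apply/funext => n; rewrite coef_geom_separated (sum_sq_probE (leqnSn n)).
  by apply: eq_bigr => j _; rewrite exit_probE.
by apply: P_recursive_diagonal; rewrite coefMC coef_map coef0_die_poly ?mul0r.
Qed.

End Rolls.

Theorem theorem4 (R : realType) (k : nat) (face : 'I_k -> nat) (p : 'I_k -> R)
    (face_inj : injective face)
    (face_gt0 : forall r : 'I_k, (0 < face r)%N)
    (p_gt0 : forall r : 'I_k, 0 < p r)
    (p_sum1 : \sum_(r < k) p r = 1)
    (d : measure_display) (T : measurableType d) (P : probability T R)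
    (X : nat -> {RV P >-> nat})
    (X_rolls : die_rolls face p X) :
  (forall n : nat, (0 < n)%N ->
     first_win_prob X n = (1 + sum_sq_prob X n) / 2%:R) /\
  P_recursive (sum_sq_prob X) /\
  P_recursive (first_win_prob X).
Proof.
have first_winE := first_win_prob_sum_sq face_inj face_gt0 p_sum1 X_rolls.
have sum_sq_rec := P_recursive_sum_sq_prob face_inj face_gt0 p_sum1 X_rolls.
split=> //; split=> //.
apply: (P_recursive_affine _ sum_sq_rec) => n n_gt0.
by rewrite first_winE // mulrDl addrC mulrC.
Qed.
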